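(* Let $a$ be a positive integer, let $n>2a$ be an integer, let $\sigma$ be a uniformly random permutation of $\{1,\ldots,n\}$, and write $p=\Pr[D_{a,a}(\sigma)=0]$. Then $p\le\frac1n$. Furthermore, unless $a=2$ and $n=5$ the inequality is strict, and unless $n=2a+1$ we have $\frac1n-p\ge\frac1{3n(n-1)}$.
   Context: For positive integers $a,b$ with $a+b<n$ and a permutation $\sigma$ of $\{1,\ldots,n\}$, define $D_{a,b}(\sigma)=\sum_{i=1}^{a}\sigma(i)-\sum_{i=a+1}^{a+b}\sigma(i)$. *)

(* Defs.v *)
From mathcomp Require Import all_boot all_order all_fingroup all_algebra.
Set Implicit Arguments.
Unset Strict Implicit.
Unset Printing Implicit Defensive.
Import Order.TTheory GRing.Theory Num.Theory.
Local Open Scope ring_scope.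

(* Ordinals are 0-based: the position i in {1, ..., n} is the ordinal of value
   i - 1, and the value sigma(i) in {1, ..., n} is (s _).+1. *)
Definition D (n a b : nat) (s : 'S_n) : int :=
  \sum_(i < n | (i < a)%N) ((s i).+1)%:Z
  - \sum_(i < n | (a <= i < a + b)%N) ((s i).+1)%:Z.

Definition uniform_Pr (T : finType) (A : {set T}) : rat :=
  #|A|%:R / #|T|%:R.

(* Main.v *)
Require Import Defs.
From mathcomp Require Import all_boot all_order all_fingroup all_algebra.
From mathcomp Require Import zify ring lra.
Import Order.TTheory GRing.Theory Num.Theory.
Local Open Scope ring_scope.

(** Record a permutation by the word whose [j]-th letter tells whether the value
    [j] is taken on the first block of positions ([A]), on the second ([B]) or
    elsewhere ([O]). Then [D] is the moment of the word, and [p = G / W], where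
    [W] counts the words with [a] letters [A] and [a] letters [B] and [G] those
    of moment [0].

    Each [A] of a word is the end of an initial part, of some length [k], of a
    maximal run of [A]s, so [a G] is the sum over [k] of the number of marked
    blocks [A^k] that start a run in a word of moment [0]. Moving such a block
    through the rest of the word raises the moment by [k] past an [O], by [2k]
    past a [B] and by [0] past an [A]; hence the rest determines the place of the
    block, and its moment must lie in a fixed class modulo [k].

    For [k >= 2] the divisibility halves the count: swapping two adjacent letters
    exactly one of which is [O] changes the moment by [1]. For [k = 1] the word is
    turned into a cyclic one. Rotating it changes the moment by multiples of [n],
    at least [a] of its [n] rotations have nonzero moment, and an [A] travelling
    once around the other [n - 1] letters meets the residue [0] modulo [n] at most
    once outside runs. The words that both start and end with [A] have to be added
    back; they are few by the block argument again.

    The sum of these bounds suffices except for [a = 2], [n <= 11] and for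
    [a = 3], [n = 8], where the words of moment [0] are counted by computation. *)

(** * Words, charges and moments *)

Local Notation letter := (option bool).
Local Notation A := (Some true : letter).
Local Notation B := (Some false : letter).
Local Notation O := (None : letter).

Definition charge (x : letter) : int :=
  match x with Some true => 1 | Some false => -1 | None => 0 end.

Fixpoint net (w : seq letter) : int :=
  if w is x :: w' then charge x + net w' else 0.

(** The sum of position times charge, with positions counted from 1: a letter put in front moves all
    later ones up by one, which adds [net w]. *)
Fixpoint moment (w : seq letter) : int :=
  if w is x :: w' then charge x + net w' + moment w' else 0.

Lemma net_cat u v : net (u ++ v) = net u + net v.
Proof. by elim: u => [|x u IH] /=; rewrite ?add0r // IH addrA. Qed.

Lemma moment_cat u v :
  moment (u ++ v) = moment u + moment v + (size u)%:Z * net v.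
Proof.
elim: u => [|x u IH] /=; first by rewrite mul0r add0r addr0.
by rewrite IH net_cat; lia.
Qed.

Lemma net_nseqA k : net (nseq k A) = k%:Z.
Proof. by elim: k => //= k ->; lia. Qed.

Lemma netE w : net w = (count_mem A w)%:Z - (count_mem B w)%:Z.
Proof. elim: w => [|x w IH] //=; rewrite IH; case: x => [[]|] /=; lia. Qed.

Lemma net_le_size w : net w <= (size w)%:Z.
Proof. by elim: w => [|[[]|] w IH] //=; lia. Qed.

Lemma net_eq_size w : net w = (size w)%:Z -> w = nseq (size w) A.
Proof.
elim: w => [|x w IH] //= h; have := net_le_size w.
case: x h => [[]|] /= h hle; [congr (_ :: _); apply: IH|..]; lia.
Qed.

Lemma last_nseqA k x : (0 < k)%N -> last x (nseq k A) = A.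
Proof. by elim: k x => //= k IH x _; case: k IH => //= k; apply. Qed.

(** Each of the [k] block letters moves up by [size z], and each letter of [z] moves down by [k]. *)
Lemma moment_shift_block u k z v :
  moment (u ++ z ++ nseq k A ++ v) - moment (u ++ nseq k A ++ z ++ v)
  = k%:Z * ((size z)%:Z - net z).
Proof.
rewrite !moment_cat !net_cat net_nseqA !size_nseq; ring.
Qed.

(** * Counting words of a given length *)

Definition nwords (m : nat) (P : pred (seq letter)) : nat :=
  #|[set t : m.-tuple letter | P t]|.

Lemma eq_nwords m P Q : P =1 Q -> nwords m P = nwords m Q.
Proof. by move=> h; apply: eq_card => t; rewrite !inE h. Qed.

Lemma leq_nwords m (P Q : pred (seq letter)) :
  (forall w, size w = m -> P w -> Q w) -> (nwords m P <= nwords m Q)%N.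
Proof.
move=> h; apply: subset_leq_card; apply/subsetP => t; rewrite !inE.
by apply: h; rewrite size_tuple.
Qed.

Lemma nwords0 P : nwords 0 P = P [::].
Proof.
rewrite /nwords; case: (boolP (P [::])) => h.
  rewrite -[RHS](card_tuple 0 letter); apply: eq_card => t.
  by rewrite !inE tuple0 h.
by apply: eq_card0 => t; rewrite !inE tuple0 (negbTE h).
Qed.

Lemma nwordsS m (P : pred (seq letter)) :
  nwords m.+1 P = (nwords m (fun w => P (A :: w)) + nwords m (fun w => P (B :: w))
               + nwords m (fun w => P (O :: w)))%N.
Proof.
have cons_inj (x : letter) : injective (fun t : m.-tuple letter => [tuple of x :: t]).
  by move=> t t' /(congr1 val) [] /val_inj.
have nwordsE x : nwords m (fun w => P (x :: w)) =
    #|[set t : m.+1.-tuple letter | P t & thead t == x]|.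
  rewrite /nwords -(card_imset _ (cons_inj x)); apply: eq_card => t.
  rewrite inE; apply/imsetP/andP => [[u] | [Pt /eqP tx]].
    by rewrite inE => Pu ->; split; rewrite // theadE.
  case/tupleP: t Pt tx => y u; rewrite theadE => Pt tx; subst y.
  by exists u; rewrite ?inE.
rewrite !nwordsE {1}/nwords -!sum1dep_card !big_mkcondr /= -!big_split /=.
by apply: eq_bigr => t _; case: (thead t) => [[]|].
Qed.

Lemma leq_card_nwords (T : finType) (S : {set T}) m (P : pred (seq letter))
    (f : T -> seq letter) :
  {in S &, injective f} -> (forall x, x \in S -> size (f x) = m /\ P (f x)) ->
  (#|S| <= nwords m P)%N.
Proof.
move=> finj fS; pose g x := insubd (nseq_tuple m O) (f x).
have gE x : x \in S -> val (g x) = f x.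
  by move=> /fS [sx _]; rewrite /g insubdK // -topredE /= sx.
rewrite -(@card_in_imset _ _ g).
  apply: subset_leq_card; apply/subsetP => _ /imsetP [x xS ->].
  by rewrite inE gE //; case: (fS x xS).
move=> x y xS yS /(congr1 val); rewrite !gE //; exact: finj.
Qed.

Lemma leq_nwords_inj m n (P Q : pred (seq letter)) (f : seq letter -> seq letter) :
  (forall w, size w = m -> P w -> size (f w) = n /\ Q (f w)) ->
  (forall w w', size w = m -> size w' = m -> P w -> P w' -> f w = f w' -> w = w') ->
  (nwords m P <= nwords n Q)%N.
Proof.
move=> fPQ finj; apply: (@leq_card_nwords _ _ _ _ (fun t => f (val t))) => [t t'|t].
  by rewrite !inE => Pt Pt' /finj e; apply/val_inj/e; rewrite ?size_tuple.
by rewrite inE; apply: fPQ; rewrite size_tuple.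
Qed.

Definition content (a b : nat) (w : seq letter) : bool :=
  (count_mem A w == a) && (count_mem B w == b).

Lemma contentP a b w :
  reflect (count_mem A w = a /\ count_mem B w = b) (content a b w).
Proof. by apply: (iffP andP) => [[/eqP ? /eqP ?]|[-> ->]]; rewrite ?eqxx. Qed.

Lemma content_net a b w : content a b w -> net w = a%:Z - b%:Z.
Proof. by case/contentP=> ha hb; rewrite netE ha hb. Qed.

Lemma nwords_pred0 m : nwords m (fun=> false) = 0%N.
Proof. by rewrite /nwords; apply: eq_card0 => t; rewrite inE. Qed.

(** Choose the charged positions, then the [A]s among them; splitting on the first letter reduces
    this to Pascal's rule. *)
Lemma nwords_contentE m a b :
  nwords m (content a b) = ('C(m, a + b) * 'C(a + b, a))%N.
Proof.
elim: m a b => [|m IH] a b.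
  by rewrite nwords0 bin0n addn_eq0 /content /=; case: a b => [|a] [|b].
rewrite nwordsS.
have -> : nwords m (fun w => content a b (A :: w)) =
    if a is a'.+1 then nwords m (content a' b) else 0%N.
  case: a => [|a']; first by apply: etrans (nwords_pred0 m); apply: eq_nwords.
  by apply: eq_nwords => w; rewrite /content /= add1n eqSS.
have -> : nwords m (fun w => content a b (B :: w)) =
    if b is b'.+1 then nwords m (content a b') else 0%N.
  case: b => [|b']; first by
    apply: etrans (nwords_pred0 m); apply: eq_nwords => w; rewrite /content /= andbF.
  by apply: eq_nwords => w; rewrite /content /= add1n eqSS.
have -> : nwords m (fun w => content a b (O :: w)) = nwords m (content a b).
  by apply: eq_nwords => w.
case: a b => [|a] [|b]; rewrite !IH ?addn0 ?add0n ?bin0 ?binn ?muln1 ?bin1 //.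
all: try by rewrite binS addnC.
rewrite !addSn !addnS (binS m) (binS (a + b).+1 a); ring.
Qed.

(** * Runs and blocks *)

(* The length of the run of [A]s that ends the word [u]. *)
Definition end_run (u : seq letter) : nat :=
  foldl (fun r x => if x == A then r.+1 else 0%N) 0%N u.

Lemma end_runP u : exists2 u', u = u' ++ nseq (end_run u) A & last O u' != A.
Proof.
elim/last_ind: u => [|u x [u' eu hl]]; first by exists [::].
rewrite /end_run foldl_rcons -/(end_run u).
case: eqP => [-> | /eqP hx]; last by exists (rcons u x); rewrite ?cats0 ?last_rcons.
exists u' => //; rewrite {1}eu rcons_cat; congr (_ ++ _).
by elim: (end_run u) => //= k ->.
Qed.

(** If [u' = u ++ z], moving the block past [z] keeps the moment, so [size z = net z] and [z]
    consists of [A]s; as [u'] does not end with [A], [z] is empty. *)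
Lemma block_position_uniq k u v u' v' :
  (0 < k)%N -> last O u != A -> last O u' != A -> u ++ v = u' ++ v' ->
  moment (u ++ nseq k A ++ v) = moment (u' ++ nseq k A ++ v') -> u = u'.
Proof.
move=> k0; wlog: u v u' v' / (size u <= size u')%N => [wl|le_uu'] hu hu' ecat emom.
  case: (leqP (size u) (size u')) => [|/ltnW] h; first exact: wl ecat emom.
  by apply/esym/(wl _ _ _ _ h _ _ (esym ecat) (esym emom)).
have eu' : u' = u ++ drop (size u) u'.
  rewrite -{1}(cat_take_drop (size u) u'); congr (_ ++ _).
  by rewrite -(take_size_cat v' (erefl (size u'))) -ecat take_takel // take_size_cat.
move: (drop _ _) eu' => z eu'; subst u'.
have {}ecat : v = z ++ v' by move/eqP: ecat; rewrite -catA eqseq_cat // eqxx => /eqP.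
subst v; have := moment_shift_block u k z v'.
rewrite emom -!catA subrr => /esym/eqP; rewrite mulf_eq0 => /orP [|/eqP hz]; first by lia.
have /net_eq_size ez : net z = (size z)%:Z by lia.
case: z ez hu' {le_uu' emom hz} => [|x z] ez; first by rewrite cats0.
by rewrite ez last_cat last_nseqA.
Qed.

Section Blocks.
Variables (n a b : nat) (v : int).

Let good := [pred w | content a b w && (moment w == v)].

(** A pair marks a block: [j] is its last position, and the run that it starts may continue beyond
    [j]. *)
Definition run_set (k : nat) : {set n.-tuple letter * 'I_n} :=
  [set x : n.-tuple letter * 'I_n | good x.1 & end_run (take x.2.+1 x.1) == k].

Lemma run_setP k w j : (w, j) \in run_set k ->
  exists u u', [/\ tval w = u ++ nseq k A ++ u', last O u != A,
    size u = (j.+1 - k)%N & u' = drop j.+1 w].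
Proof.
rewrite inE /= => /andP [_ /eqP ek].
have [u eu lu] := end_runP (take j.+1 w); rewrite ek in eu.
exists u, (drop j.+1 w); split=> //.
  by rewrite catA -eu cat_take_drop.
have := congr1 size eu; rewrite size_cat size_nseq size_takel ?size_tuple //; lia.
Qed.

(** Delete the block: [block_position_uniq] recovers its place, and moving it to the front changes
    the moment by a multiple of [k]. *)
Lemma leq_run_set k : (0 < k)%N ->
  (#|run_set k| <= nwords (n - k) [pred w | content (a - k) b w
                                & (k%:Z %| (moment (nseq k A ++ w) - v)%R)%Z])%N.
Proof.
move=> k0.
pose f (x : n.-tuple letter * 'I_n) := take (x.2.+1 - k) x.1 ++ drop x.2.+1 x.1.
apply: (@leq_card_nwords _ _ _ _ f); rewrite /f {f}.
  move=> [w j] [w' j'] hx hx' /=.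
  have [u [z [ew lu su ez]]] := run_setP _ _ _ hx.
  have [u' [z' [ew' lu' su' ez']]] := run_setP _ _ _ hx'.
  rewrite -ez -ez' ew ew' -su -su' !take_size_cat // => ecat.
  have em : moment (u ++ nseq k A ++ z) = moment (u' ++ nseq k A ++ z').
    move: hx hx'; rewrite !inE -ew -ew' /= => /andP [/andP [_ /eqP ->] _].
    by move=> /andP [/andP [_ /eqP ->] _].
  have eu := block_position_uniq k u z u' z' k0 lu lu' ecat em.
  move/eqP: ecat; rewrite {1}eu eqseq_cat // eqxx /= => /eqP e.
  have eww : w = w' by apply: val_inj; rewrite /= ew ew' e eu.
  congr (_, _) => //; apply: val_inj => /=.
  have := congr1 size e; rewrite ez ez' !size_drop !size_tuple.
  by have := ltn_ord j; have := ltn_ord j'; lia.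
move=> [w j] hx /=; have [u [z [ew lu su ez]]] := run_setP _ _ _ hx.
have := congr1 size ew; rewrite size_tuple !size_cat size_nseq => sn.
rewrite -ez ew -su take_size_cat //; split; first by rewrite sn addnCA addKn.
move: hx; rewrite inE ew /= => /andP [/andP [/contentP [cA cB] /eqP em] _].
apply/andP; split.
  apply/contentP; move: cA cB; rewrite !count_cat !count_nseq /=; lia.
have := moment_shift_block [::] k u z; rewrite /= em => e.
have -> : moment (nseq k A ++ u ++ z) - v = k%:Z * (net u - (size u)%:Z) by lia.
exact: dvdz_mulr.
Qed.

(* Each [A] of a word is the end of exactly one block counted in a [run_set]. *)
Lemma leq_sum_run_set : (a * nwords n good <= \sum_(k < a) #|run_set k.+1|)%N.
Proof.
pose X := [set x : n.-tuple letter * 'I_n | good x.1 & tnth x.1 x.2 == A].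
have -> : (a * nwords n good)%N = #|X|.
  transitivity (\sum_(w : n.-tuple letter | good w) \sum_(j | tnth w j == A) 1)%N.
    rewrite (eq_bigr (fun=> a)); first by rewrite sum_nat_cond_const mulnC /nwords -cardsE.
    move=> w /andP [/contentP [cA _] _]; rewrite -cA sum1_card -[in RHS](map_tnth_enum w).
    by rewrite count_map cardE size_filter /enum_mem filter_predT.
  by rewrite pair_big_dep sum1dep_card.
rewrite -sum1_card.
under [X in (_ <= X)%N]eq_bigr do rewrite -sum1_card big_mkcond.
rewrite exchange_big [X in (X <= _)%N]big_mkcond; apply: leq_sum => [[w j]] _.
case: ifP => // ; rewrite inE /= => /andP [hw hj].
have [u eu lu] := end_runP (take j.+1 w).
set k := end_run (take j.+1 w) in eu.
have ha : (k <= a)%N.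
  case/andP: hw => /contentP [<- _] _.
  by rewrite -(cat_take_drop j.+1 w) eu !count_cat count_nseq /=; lia.
have hk : (0 < k)%N.
  rewrite lt0n; apply/eqP => k0; rewrite k0 cats0 in eu; move: lu.
  rewrite -eu (take_nth O) ?size_tuple // last_rcons -tnth_nth.
  by rewrite (eqP hj).
have hk1 : (k.-1 < a)%N by lia.
rewrite (bigD1 (Ordinal hk1)) //= inE /= -/k prednK // hw eqxx; exact: leq_addr.
Qed.

End Blocks.

(** * Concentration of the moment *)

(** A double count of the longer words with one marked [A]: deleting it leaves [m] letters with
    [m.+1] places for it. *)
Lemma nwords_content_step m a b :
  (m.+1 * nwords m (content a b) = a.+1 * nwords m.+1 (content a.+1 b))%N.
Proof.
rewrite !nwords_contentE mulnA addSn.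
have -> : (m.+1 * 'C(m, a + b) = (a + b).+1 * 'C(m.+1, (a + b).+1))%N.
  by rewrite mul_bin_diag.
rewrite -mulnA mulnCA [X in (_ * X)%N]mul_bin_diag; ring.
Qed.

(** A hockey-stick identity: [c], the number of letters other than [A], stays fixed while [A]s are
    deleted. *)
Lemma nwords_content_sum c a b :
  (c.+1 * (\sum_(k < a) nwords (c + a - k.+1) (content (a - k.+1) b))
   = a * nwords (c + a) (content a b))%N.
Proof.
elim: a => [|a IH]; first by rewrite big_ord0 muln0.
rewrite big_ord_recl /= mulnDr.
have -> : (\sum_(i < a) nwords (c + a.+1 - (bump 0 i).+1) (content (a.+1 - (bump 0 i).+1) b)
  = \sum_(k < a) nwords (c + a - k.+1) (content (a - k.+1) b))%N.
  by apply: eq_bigr => i _; rewrite /bump add1n addnS !subSS.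
by rewrite IH addnS !subn1 /= -mulnDl -nwords_content_step addSn.
Qed.

(** Sum [leq_run_set] over all block lengths with the divisibility dropped. *)
Lemma moment_concentration c a b v : (0 < a)%N ->
  (c.+1 * nwords (c + a) [pred w | content a b w & moment w == v]
   <= nwords (c + a) (content a b))%N.
Proof.
move=> a0; rewrite -(leq_pmul2l a0) mulnCA -nwords_content_sum leq_pmul2l //.
apply: leq_trans (leq_sum_run_set _ _ _ _) _; apply: leq_sum => k _.
apply: leq_trans (leq_run_set _ _ _ _ _ _) _ => //.
by apply: leq_nwords => w _ /andP [].
Qed.

Definition flip (x : letter) : letter := omap negb x.

Lemma flipK : involutive flip. Proof. by case=> [[]|]. Qed.

Lemma moment_flip w : moment (map flip w) = - moment w.
Proof.
have net_flip u : net (map flip u) = - net u.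
  by elim: u => //= x u ->; case: x => [[]|] /=; lia.
by elim: w => //= x w ->; rewrite net_flip; case: x => [[]|] /=; lia.
Qed.

Lemma content_flip a b w : content a b (map flip w) = content b a w.
Proof.
rewrite /content andbC !count_map.
rewrite (@eq_count _ (preim flip (pred1 A)) (pred1 B)); last by move=> [[]|].
by rewrite (@eq_count _ (preim flip (pred1 B)) (pred1 A)) // => -[[]|].
Qed.

(** Exchanging [A] and [B] negates the moment. This form serves words without [A]. *)
Lemma moment_concentration_flip c a b v : (0 < b)%N ->
  (c.+1 * nwords (c + b) [pred w | content a b w & moment w == v]
   <= nwords (c + b) (content a b))%N.
Proof.
move=> b0; have nwords_flip P Q : (forall w, P w = Q (map flip w)) ->
    (nwords (c + b) P <= nwords (c + b) Q)%N.
  move=> PQ; apply: (leq_nwords_inj _ _ _ _ (map flip)) => [w sw|w w' _ _ _ _].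
    by rewrite PQ size_map.
  by apply: inj_map; apply: inv_inj flipK.
apply: leq_trans (nwords_flip (content b a) _ _); last first.
  by move=> w; rewrite content_flip.
apply: leq_trans (moment_concentration c b a (- v) b0).
rewrite leq_pmul2l //; apply: nwords_flip => w /=.
by rewrite content_flip moment_flip eqr_opp.
Qed.

(** * Divisibility of the moment *)

(* The positions are paired as (1,2), (3,4), ...; a word is rigid when no pair
   has exactly one neutral letter, so that no swap inside a pair changes the
   moment by one. *)
Fixpoint rigid (w : seq letter) : bool :=
  if w is x :: (y :: w') then ((x == O) == (y == O)) && rigid w' else true.

(** [i] and [j] count the letters [A] and [B] already read, so that recursion on the first letter
    keeps [a] and [b] fixed. *)
Definition ocontent (i j a b : nat) (w : seq letter) : bool :=
  ((i + count_mem A w == a) && (j + count_mem B w == b))%N.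

Section Divisible.
Variables (k a b : nat).

(** The words are suffixes: [c] letters precede them and [s] collects the moment of the part already
    read. *)
Let E m i j (c s : int) := nwords m [pred w | ocontent i j a b w
  & (k%:Z %| (moment w + c * net w + s)%R)%Z].
Let W m i j := nwords m (ocontent i j a b).
Let R m i j := nwords m [pred w | ocontent i j a b w & rigid w].

Lemma ocontent_cons i j x w :
  ocontent i j a b (x :: w) = ocontent (i + (x == A))%N (j + (x == B))%N a b w.
Proof. by rewrite /ocontent /= !addnA. Qed.

Let ES m i j c s : E m.+1 i j c s =
  (E m i.+1 j (c + 1) (s + (c + 1)) + E m i j.+1 (c + 1) (s - (c + 1))
   + E m i j (c + 1) s)%N.
Proof.
rewrite /E nwordsS; congr (_ + _ + _)%N; apply: eq_nwords => w;
  rewrite /= ocontent_cons /= ?addn0 ?addn1; congr (_ && (_ %| _)%Z); ring.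
Qed.

Lemma ocontentS m i j : W m.+1 i j = (W m i.+1 j + W m i j.+1 + W m i j)%N.
Proof.
rewrite /W nwordsS; congr (_ + _ + _)%N; apply: eq_nwords => w;
  by rewrite /= ocontent_cons /= ?addn0 ?addn1.
Qed.

Lemma rigidSS m i j : R m.+2 i j =
  (R m i.+2 j + 2 * R m i.+1 j.+1 + R m i j.+2 + R m i j)%N.
Proof.
have RE x y : nwords m (fun w => ocontent i j a b (x :: y :: w) && rigid (x :: y :: w)) =
    if (x == O) == (y == O) then
      R m (i + (x == A) + (y == A)) (j + (x == B) + (y == B)) else 0%N.
  case: ifP => h; last first.
    by apply: etrans (nwords_pred0 m); apply: eq_nwords => w; rewrite /= h andbF.
  by apply: eq_nwords => w; rewrite /= h !ocontent_cons.
rewrite {1}/R !nwordsS /= !RE /= ?addn0 ?addn1; ring.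
Qed.

Hypothesis k_gt1 : (1 < k)%N.

Let E_succ m i j c s : (E m i j c s + E m i j c (s + 1) <= W m i j)%N.
Proof.
rewrite /E /W /nwords -cardsUI.
rewrite [X in (_ + X)%N]eq_card0 ?addn0 => [|t].
  apply: subset_leq_card; apply/subsetP => t; rewrite !inE.
  by case/orP => /andP [].
rewrite !inE /=; apply/negP => /andP [/andP [_ h1] /andP [_ h2]].
have := rpredB h2 h1; rewrite -!addrA; set x := (X in (_ %| X)%Z).
have -> : x = 1 by rewrite /x; ring.
by rewrite dvdz1 /=; lia.
Qed.

(** Read two letters at a time. Pairs with exactly one [O] come with their swaps, whose moments
    differ by 1, so [E_succ] admits at most half of them; the other pairs go by induction. *)
Let E_le_rigid m i j c s : (2 * E m i j c s <= W m i j + R m i j)%N.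
Proof.
have H n : forall i j c s, (2 * E n i j c s <= W n i j + R n i j)%N /\
    (2 * E n.+1 i j c s <= W n.+1 i j + R n.+1 i j)%N.
  elim: n => [|n IH] {}i {}j {}c {}s; last first.
    split; first by case: (IH i j c s).
    rewrite !(ES, ocontentS, rigidSS).
    have e1 := E_succ n i.+1 j (c + 1 + 1) (s + (c + 1)).
    have e2 := E_succ n i j.+1 (c + 1 + 1) (s - (c + 1 + 1)).
    have [f1 _] := IH i.+2 j (c + 1 + 1) (s + (c + 1) + (c + 1 + 1)).
    have [f2 _] := IH i.+1 j.+1 (c + 1 + 1) (s + (c + 1) - (c + 1 + 1)).
    have [f3 _] := IH i.+1 j.+1 (c + 1 + 1) (s - (c + 1) + (c + 1 + 1)).
    have [f4 _] := IH i j.+2 (c + 1 + 1) (s - (c + 1) - (c + 1 + 1)).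
    have [f5 _] := IH i j (c + 1 + 1) s.
    have g1 : s + (c + 1) + 1 = s + (c + 1 + 1) by ring.
    have g2 : s - (c + 1 + 1) + 1 = s - (c + 1) by ring.
    rewrite g1 in e1; rewrite g2 in e2; lia.
  have EW n : (E n i j c s <= W n i j)%N by apply: leq_nwords => w _ /andP [].
  have RW n : (n < 2)%N -> R n i j = W n i j.
    move=> hm; apply/eqP; rewrite eqn_leq; apply/andP; split; apply: leq_nwords => w sw.
      by case/andP.
    by move=> /= ->; case: w sw => [|x [|y w]] //= sw; rewrite -sw in hm.
  by rewrite !RW // !addnn !mul2n !leq_double !EW.
by case: (H m i j c s).
Qed.

Lemma nwords_dvd_moment m s :
  (2 * nwords m [pred w | content a b w & (k%:Z %| (moment w + s)%R)%Z]
   <= nwords m (content a b) + nwords m [pred w | content a b w & rigid w])%N.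
Proof.
have := E_le_rigid m 0 0 0 s; congr (_ * _ <= _ + _)%N.
by apply: eq_nwords => w /=; rewrite mul0r addr0.
Qed.

End Divisible.

(** * Rarity of rigid words *)

(** The number of choices of [t] among [m] positions made of whole pairs, plus the unpaired last
    position when [m] and [t] are odd. *)
Definition nrigid (m t : nat) : nat :=
  if ~~ odd m && odd t then 0%N else 'C(m./2, t./2).

Lemma nrigidSS m t : nrigid m.+2 t.+2 = (nrigid m t.+2 + nrigid m t)%N.
Proof. by rewrite /nrigid /= !negbK binS; case: ifP. Qed.

Lemma leq_bin_mul p q i j : ('C(p, i) * 'C(q, j) <= 'C(p + q, i + j))%N.
Proof.
rewrite -binomial.Vandermonde.
have hi : (i < (i + j).+1)%N by rewrite ltnS leq_addr.
by rewrite (bigD1 (Ordinal hi)) //= addKn leq_addr.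
Qed.

(** Split the [m] positions into [m./2.+1] and the rest: the left side, if not 0, is a factor of one
    Vandermonde term whose other factor is positive. *)
Lemma nrigid_le_bin m t : (1 < t <= m)%N -> (nrigid m.+2 t <= 'C(m, t.-1))%N.
Proof.
case/andP=> t1 tm; rewrite /nrigid /= negbK; case: ifP => // odd_mt.
have em := odd_double_half m; have et := odd_double_half t.
set M := m./2 in em *; set v := t./2 in et *.
have bpos q i : (i <= q)%N -> (0 < 'C(q, i))%N by rewrite bin_gt0.
case: (boolP (odd m)) odd_mt em => om; rewrite ?om /= => odd_mt em.
  have := leq_bin_mul M.+1 M v (t.-1 - v).
  have -> : (M.+1 + M = m)%N by lia.
  have -> : (v + (t.-1 - v) = t.-1)%N by lia.
  by apply: leq_trans; apply: leq_pmulr; apply: bpos; lia.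
have := leq_bin_mul M.+1 M.-1 v (t.-1 - v).
have -> : (M.+1 + M.-1 = m)%N by lia.
have -> : (v + (t.-1 - v) = t.-1)%N by lia.
by apply: leq_trans; apply: leq_pmulr; apply: bpos; lia.
Qed.

(** Induction by steps of 2. In Pascal's rule applied twice, the outer terms take the induction
    hypotheses, and the doubled middle term pays for the growth of the factor [m.-1] by 2, through
    [nrigid_le_bin]. The extreme values of [t], outside the range of the hypotheses, are
    separate. *)
Lemma nrigid_le n s : (0 < s < n)%N -> (n.-1 * nrigid n s <= 'C(n, s))%N.
Proof.
have H m : (forall t, 0 < t < m -> m.-1 * nrigid m t <= 'C(m, t))%N /\
    (forall t, 0 < t < m.+1 -> m * nrigid m.+1 t <= 'C(m.+1, t))%N.
  elim: m => [|m [IH IH1]]; first by split; [case|move=> [|[]]].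
  split=> // t /andP [t0 tm].
  have [t2|t1] := leqP 2 t; last first.
    have -> : t = 1%N by lia.
    rewrite bin1 /nrigid /= negbK; case: ifP => [_|_]; first by rewrite muln0.
    rewrite ?bin0; lia.
  have [tm1|tm1] := eqVneq t m.+1.
    have -> : 'C(m.+2, t) = m.+2 by rewrite tm1 -bin_sub // subSnn bin1.
    rewrite tm1 /nrigid /= negbK; case: ifP => [_|odd_m]; first by rewrite muln0.
    have -> : 'C(m./2.+1, uphalf m) = 1%N; last by lia.
    by rewrite uphalf_half; move: odd_m; case: (odd m) => //= _; rewrite add1n binn.
  have tlem : (t <= m)%N by lia.
  have h := nrigid_le_bin m t; rewrite t2 tlem in h; have {}h := h isT.
  case: t t0 tm t2 tm1 tlem h => [|[|t]] // _ _ _ _ tlem h.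
  have [tm2|tm2] := eqVneq t.+2 m.
    have -> : 'C(m.+2, t.+2) = 'C(m.+2, 2) by rewrite tm2 -bin_sub; [congr ('C(_, _))|]; lia.
    rewrite bin2 /nrigid /= negbK; case: ifP => [_|_]; first by rewrite muln0.
    have : ('C(m./2.+1, t./2.+1) <= m./2.+1)%N.
      have -> : t./2.+1 = m./2 by rewrite -tm2.
      by rewrite -bin_sub // subSnn bin1.
    rewrite -divn2 => hb; have := odd_double_half m; rewrite -divn2.
    move: ('C(_, _)) hb => x hb; nia.
  have [t0|t0] := posnP t.
    rewrite t0 bin2 /nrigid /= negbK; case: ifP => [_|_]; first by rewrite muln0.
    rewrite bin1.
    rewrite -divn2; have := odd_double_half m; nia.
  rewrite !binS nrigidSS in h *.
  have h1 := IH t.+2; have h2 := IH t.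
  have /h1 {}h1 : (0 < t.+2 < m)%N by lia.
  have /h2 {}h2 : (0 < t < m)%N by lia.
  move: h1 h2 h; rewrite /= .
  have -> : m = m.-1.+1 by lia.
  move: (nrigid _ _) (nrigid _ _) => x y /=.
  nia.
by case: (H n) => + _; apply.
Qed.

Lemma bin_SS s x y : (x + y = s.+2)%N ->
  ((if (1 < x)%N then 'C(s, x - 2) else 0)
   + 2 * (if (0 < x) && (0 < y) then 'C(s, x - 1) else 0)
   + (if (1 < y)%N then 'C(s, x) else 0) = 'C(s.+2, x))%N.
Proof.
move=> exy; have -> : (if (1 < y)%N then 'C(s, x) else 0%N) = 'C(s, x).
  by case: ltnP => // h; rewrite bin_small //; lia.
case: x exy => [|[|x]] exy; first by rewrite !bin0.
  have -> : (0 < y)%N by lia.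
  by rewrite /= subnn bin0 !bin1; lia.
have -> : (if ((0 < x.+2) && (0 < y))%N then 'C(s, x.+2 - 1) else 0%N) = 'C(s, x.+1).
  by rewrite subn1 /=; case: ltnP => // h; rewrite bin_small //; lia.
by rewrite subn2 /= !binS; ring.
Qed.

(** Choose the charged positions as a rigid set, then the [A]s among them; [FSS] is the matching
    recursion by pairs of letters. *)
Lemma nwords_rigid_le m a b :
  (nwords m [pred w | content a b w & rigid w] <= nrigid m (a + b) * 'C(a + b, a))%N.
Proof.
pose F m x y := (nrigid m (x + y) * 'C(x + y, x))%N.
have FSS m' x y : ((if (1 < x)%N then F m' (x - 2) y else 0) +
    2 * (if (0 < x) && (0 < y) then F m' (x - 1) (y - 1) else 0) +
    (if (1 < y)%N then F m' x (y - 2) else 0) + F m' x y <= F m'.+2 x y)%N.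
  have [h|h] := leqP 2 (x + y); last first.
    have -> : (1 < x)%N = false by lia.
    have -> : (1 < y)%N = false by lia.
    have -> : ((0 < x) && (0 < y))%N = false by lia.
    rewrite muln0 /F !add0n leq_pmul2r ?bin_gt0 ?leq_addr // /nrigid /= negbK.
    have -> : (x + y)./2 = 0%N by lia.
    by rewrite !bin0.
  have [s es] : {s | (x + y = s.+2)%N} by exists (x + y - 2)%N; lia.
  rewrite /F es nrigidSS mulnDl addnC leq_add2l -(bin_SS s x y es).
  rewrite 2!mulnDr mulnCA; apply: leq_add; first apply: leq_add.
  - by case: ifP => // hx; have -> : (x - 2 + y)%N = s by lia.
  - rewrite leq_pmul2l //; case: ifP => // hxy.
    by have -> : (x - 1 + (y - 1))%N = s by lia.
  - by case: ifP => // hy; have -> : (x + (y - 2))%N = s by lia.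
have H m' : forall i j,
    (nwords m' [pred w | ocontent i j a b w & rigid w] <=
     if (i <= a) && (j <= b) then F m' (a - i) (b - j) else 0)%N /\
    (nwords m'.+1 [pred w | ocontent i j a b w & rigid w] <=
     if (i <= a) && (j <= b) then F m'.+1 (a - i) (b - j) else 0)%N.
  elim: m' => [|m' IH] i j; last first.
    split; first by case: (IH i j).
    rewrite rigidSS.
    have := FSS m' (a - i)%N (b - j)%N.
    have [f1 _] := IH i.+2 j; have [f2 _] := IH i.+1 j.+1.
    have [f3 _] := IH i j.+2; have [f4 _] := IH i j.
    have e1 : (1 < a - i)%N = (i.+2 <= a)%N by lia.
    have e2 : ((0 < a - i) && (0 < b - j))%N = ((i.+1 <= a) && (j.+1 <= b))%N by lia.
    have e3 : (1 < b - j)%N = (j.+2 <= b)%N by lia.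
    rewrite e1 e2 e3 -!subnDA !addn1 !addn2; move: f1 f2 f3 f4.
    have [ia|ia] := leqP i a; last first.
      have -> : (i.+2 <= a)%N = false by lia.
      have -> : (i.+1 <= a)%N = false by lia.
      by rewrite /=; lia.
    have [jb|jb] := leqP j b; last first.
      have -> : (j.+2 <= b)%N = false by lia.
      have -> : (j.+1 <= b)%N = false by lia.
      by rewrite !andbF; lia.
    by rewrite /= andbT; lia.
  rewrite nwordsS !nwords0 /F /ocontent /nrigid /= !andbT !addn0 !addn1.
  case: (leqP i a) => ia; case: (leqP j b) => jb /=.
  2-4: by split; lia.
  have -> : (i == a) = (a - i == 0)%N by lia.
  have -> : (j == b) = (b - j == 0)%N by lia.
  have -> : (i.+1 == a) = (a - i == 1)%N by lia.
  have -> : (j.+1 == b) = (b - j == 1)%N by lia.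
  by move: (a - i)%N (b - j)%N => [|[|x]] [|[|y]].
by have [+ _] := H m 0%N 0%N; rewrite !subn0.
Qed.

Lemma rigid_rare m a b : (0 < a + b < m)%N ->
  (m.-1 * nwords m [pred w | content a b w & rigid w] <= nwords m (content a b))%N.
Proof.
move=> hab; rewrite nwords_contentE.
apply: leq_trans (_ : m.-1 * (nrigid m (a + b) * 'C(a + b, a)) <= _)%N.
  by rewrite leq_mul2l nwords_rigid_le orbT.
by rewrite mulnA leq_mul2r nrigid_le ?orbT.
Qed.

Lemma nwords_dvd_moment_le k m a b s : (1 < k)%N -> (0 < a + b < m)%N ->
  (2 * m.-1 * nwords m [pred w | content a b w & (k%:Z %| (moment w + s)%R)%Z]
   <= m * nwords m (content a b))%N.
Proof.
have arith r e W : (0 < m)%N -> (m.-1 * r <= W)%N -> (2 * e <= W + r)%N ->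
    (2 * m.-1 * e <= m * W)%N by case: m => // m _ /=; nia.
move=> k1 hab; apply: arith (rigid_rare m a b hab) (nwords_dvd_moment k a b k1 m s).
by lia.
Qed.

(** * Cyclic words *)

(** The letters sent to the back move up by [size w - c], the others down by [c], and the two parts
    have opposite net charges. *)
Lemma moment_rot c w : net w = 0 ->
  moment (rot c w) = moment w + (size w)%:Z * net (take c w).
Proof.
rewrite /rot; move: (cat_take_drop c w).
move: (take c w) (drop c w) => u z <-; rewrite net_cat size_cat !moment_cat PoszD => h.
have -> : net z = - net u by lia.
ring.
Qed.

(* A nonneutral letter separates two prefixes with different net charges, so it
   has an end outside the level [t]; each prefix is an end of two letters. *)
Lemma card_level n a w t : size w = n -> content a a w ->
  (#|[set c : 'I_n | net (take c.+1 w) == t]| + a <= n)%N.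
Proof.
move=> sw cw; have net0 : net w = 0 by rewrite (content_net _ _ _ cw) subrr.
pose b c : nat := net (take c w) != t.
have bE : (#|[set c : 'I_n | net (take c.+1 w) == t]| + \sum_(c < n) b c.+1 = n)%N.
  rewrite -sum1dep_card big_mkcond -big_split /= -[RHS]card_ord -sum1_card.
  by apply: eq_bigr => c _; rewrite /b; case: eqP.
rewrite -[X in (_ <= X)%N]bE leq_add2l -leq_double.
have -> : (a.*2 = \sum_(c < n) (nth O w c != O))%N.
  have -> : (a.*2 = count (predC1 O) w)%N.
    have [cA cB] := contentP _ _ _ cw.
    have -> : (a.*2 = count_mem A w + count_mem B w)%N by lia.
    by elim: w {sw net0 b bE cw cA cB} => // -[[]|] w /= <-; lia.
  rewrite -sum1_count big_mkcond (big_nth O) big_mkord sw.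
  by apply: eq_bigr => c _ /=; case: (nth O w c).
have shift : (\sum_(c < n) b c = \sum_(c < n) b c.+1)%N.
  have := big_ord_recl n (fun c : 'I_n.+1 => b c) (op := addn) (idx := 0%N).
  have -> : b (@ord0 n) = b n by rewrite /b take0 take_oversize ?sw // net0.
  by rewrite big_ord_recr /= addnC => /addnI ->.
rewrite -addnn -{1}shift -big_split; apply: leq_sum => c _.
rewrite /b (take_nth O) ?sw // -cats1 net_cat /=.
by case: (nth O w c) => [[]|] //=; case: eqP => //; case: eqP => //=; lia.
Qed.

Section Cyclic.
Variables (n a : nat).
Hypotheses (a_gt0 : (0 < a)%N) (n_gt2a : (2 * a < n)%N).

(** A cyclic word read from just after a marked [A] whose cyclic predecessor is not [A]. Rotation
    preserves the residue modulo [n], so only that is kept. *)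
Let Q := [pred v | [&& content a.-1 a v, last O v != A
                    & (n%:Z %| moment (A :: v))%Z]].

(** Rotation is injective on pairs of a word of [Q] and a shift: otherwise a marked [A] moves past a
    part [y] with [size y - net y] equal to 0 or [n]. Then [y], or the rest [r], consists of [A]s,
    against the condition on the last letter. *)
Lemma cyclic_insertion :
  (n.-1 * nwords n.-1 Q <= nwords n.-1 (content a.-1 a))%N.
Proof.
set m := n.-1.
have -> : (m * nwords m Q = #|setX [set t : m.-tuple letter | Q t] [set: 'I_m]|)%N.
  by rewrite cardsX cardsT card_ord mulnC.
pose f (x : m.-tuple letter * 'I_m) := rotr x.2 x.1.
apply: (@leq_card_nwords _ _ _ _ f) => [[q t] [q' t']|[q t]]; last first.
  rewrite !inE andbT /f /= => /and3P [/contentP [cA cB] _ _].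
  rewrite size_rotr size_tuple; split=> //; apply/contentP.
  have /seq.permP h : perm_eq (rotr t q) q by rewrite perm_rotr.
  by rewrite !h.
rewrite !inE !andbT /f /= => Qq Qq' erot.
wlog: q t q' t' Qq Qq' erot / (t <= t')%N => [wl|].
  case: (leqP t t') => [|/ltnW] h; first exact: wl.
  by apply/esym/wl.
rewrite leq_eqVlt => /orP [/eqP /val_inj ett|ltt].
  by subst t'; congr (_, _); apply/val_inj/(can_inj (rotrK t) erot).
exfalso; set v : seq letter := rotr t q in erot.
have eq1 : tval q = rot t v by rewrite /v rotrK.
have eq2 : tval q' = rot t' v by rewrite erot rotrK.
have sv : size v = m by rewrite /v size_rotr size_tuple.
have [x [y [z [ev sx sy]]]] : exists x y z : seq letter, [/\ v = x ++ y ++ z, size x = t &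
    size y = (t' - t)%N].
  exists (take t v), (take (t' - t) (drop t v)), (drop (t' - t) (drop t v)).
  have ht' := ltn_ord t'.
  rewrite !cat_take_drop; split=> //; rewrite size_takel ?size_drop ?sv //; lia.
have eqa : tval q = y ++ (z ++ x) by rewrite eq1 ev -sx rot_size_cat catA.
have eqb : tval q' = (z ++ x) ++ y.
  have -> : tval q' = rot (size (x ++ y)) v.
    by rewrite eq2 size_cat sx sy subnKC // ltnW.
  by rewrite ev catA rot_size_cat catA.
move: Qq Qq'; rewrite eqa eqb => /and3P [cq lq dq] /and3P [_ lq' dq'].
have svx : (size x + (size y + size z) = m)%N by rewrite -sv ev !size_cat.
have sz : (0 < size z)%N by have := ltn_ord t'; lia.
set r : seq letter := z ++ x in cq lq dq lq' dq'.
have nr : net y + net r = -1 by rewrite -net_cat (content_net _ _ _ cq); lia.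
have szr : (size r + size y = m)%N by rewrite size_cat; lia.
have r0 : (0 < size r)%N by rewrite size_cat; lia.
clearbody r.
have : (n%:Z %| (size y)%:Z - net y)%Z.
  (* Moving [A] past [y] adds [size y - net y]; rotating [y] to the back then adds [n] times
     [net y]. *)
  have -> : (size y)%:Z - net y = moment (A :: r ++ y) - moment (A :: y ++ r) - n%:Z * net y.
    rewrite /= !moment_cat !net_cat.
    have -> : net r = -1 - net y by lia.
    have -> : n%:Z = (size r)%:Z + (size y)%:Z + 1 by lia.
    ring.
  by rewrite rpredB // ?dvdz_mulr // rpredB.
have hy := net_le_size y; have hr := net_le_size r.
case/dvdzP => k ek.
have n0 : 0 < n%:Z by lia.
have k_ge0 : 0 <= k by rewrite -(pmulr_lge0 _ n0) -ek subr_ge0.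
have k_le1 : k <= 1 by rewrite -(ler_pM2r n0) -ek mul1r; lia.
have [k0|k1] : k = 0 \/ k = 1 by lia.
  have /net_eq_size ey : net y = (size y)%:Z by rewrite k0 mul0r in ek; lia.
  by move: lq'; rewrite last_cat ey last_nseqA //; lia.
have /net_eq_size er : net r = (size r)%:Z by rewrite k1 mul1r in ek; lia.
by move: lq; rewrite last_cat er last_nseqA.
Qed.

(** The letter before the [A] is taken cyclically. Only words that begin and end with [A], marked at
    the first position, are left out. *)
Definition isolated_set : {set n.-tuple letter * 'I_n} :=
  [set x in run_set n a a 0 1 | last O (drop x.2.+1 x.1 ++ take x.2 x.1) != A].

(** A pair is a word of [Q] with a rotation of moment 0; [card_level] allows at most [n - a] such
    rotations. *)
Lemma leq_isolated_set : (#|isolated_set| <= (n - a) * nwords n.-1 Q)%N.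
Proof.
have n0 : (0 < n)%N by lia.
pose V (v : seq letter) := A :: v.
pose Z := [set y : n.-1.-tuple letter * 'I_n |
  Q y.1 & moment (rot y.2.+1 (V y.1)) == 0].
have cV (v : seq letter) : content a.-1 a v -> content a a (V v).
  by case/contentP => cA cB; apply/contentP; rewrite /= cA cB; lia.
have QV (v : seq letter) c : size v = n.-1 -> content a.-1 a v ->
    moment (rot c (V v)) = moment (V v) + n%:Z * net (take c (V v)).
  move=> sv /cV cv; have sV : size (V v) = n by rewrite /= sv prednK.
  by have := moment_rot c (V v); rewrite sV (content_net _ _ _ cv) subrr; apply.
apply: (@leq_trans #|Z|).
  (* Rotating by [n - j], the successor of [rev_ord j], puts the [A] back at position [j]. *)
  pose g (x : n.-tuple letter * 'I_n) :=
    (insubd (nseq_tuple n.-1 O) (drop x.2.+1 x.1 ++ take x.2 x.1), rev_ord x.2).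
  have gE x : val (g x).1 = drop x.2.+1 x.1 ++ take x.2 x.1.
    rewrite /g /= insubdK // -topredE /= size_cat size_drop size_takel !size_tuple.
      by have := ltn_ord x.2; lia.
    by rewrite ltnW.
  have gK x : x \in isolated_set -> rot (g x).2.+1 (V (g x).1) = x.1.
    case: x => w j; rewrite inE => /andP [/run_setP [u [z [ew _ su ez]]] _].
    have su' : size u = j by lia.
    have ew' : tval w = u ++ A :: z by [].
    have -> : (g (w, j)).1 = drop j.+1 w ++ take j w :> seq letter by rewrite gE.
    rewrite -ez ew' -su' take_size_cat // /V -cat_cons.
    have -> : (g (w, j)).2.+1 = size (A :: z); last by rewrite rot_size_cat.
    rewrite ez /= size_drop size_tuple; have := ltn_ord j; lia.
  rewrite -(@card_in_imset _ _ g).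
    apply: subset_leq_card; apply/subsetP => _ /imsetP [x xS ->].
    have gx := gK _ xS; move: xS; rewrite !inE => /andP [/andP [/andP [cx /eqP mx] _] lx].
    rewrite gx mx eqxx andbT gE.
    set v : seq letter := drop _ _ ++ _ in lx *.
    have ev : val (g x).1 = v by rewrite gE.
    have sv : size v = n.-1 by rewrite -ev size_tuple.
    have cv : content a.-1 a v.
      rewrite ev in gx; apply/contentP.
      have /seq.permP h : perm_eq (rot (g x).2.+1 (V v)) (V v) by rewrite perm_rot.
      move: cx => /contentP []; rewrite -gx !h /=; lia.
    have := QV v (g x).2.+1 sv cv.
    rewrite -ev gx mx ev => /eqP; rewrite eq_sym addr_eq0 => /eqP dv.
    by apply/and3P; split=> //; rewrite -/(V v) dv rpredN dvdz_mulr.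
  move=> x y xS yS exy; have := gK _ xS; have := gK _ yS; rewrite exy => -> /val_inj e1.
  have := congr1 snd exy; rewrite /= => /rev_ord_inj e2.
  by case: x y e1 e2 {exy xS yS} => [w j] [w' j'] /= -> ->.
have -> : #|Z| = (\sum_(v : n.-1.-tuple letter | Q v)
    #|[set c : 'I_n | moment (rot c.+1 (V v)) == 0]|)%N.
  rewrite -sum1dep_card; under [RHS]eq_bigr do rewrite -sum1dep_card.
  by rewrite pair_big_dep.
apply: leq_trans (_ : \sum_(v : n.-1.-tuple letter | Q v) (n - a) <= _)%N; last first.
  by rewrite sum_nat_cond_const mulnC /nwords cardsE.
apply: leq_sum => v /and3P [cv _ /dvdzP [k ek]].
rewrite leq_subRL; last by lia.
rewrite addnC; apply: leq_trans (card_level n a (V v) (- k) _ (cV _ cv)); last first.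
  by rewrite /= size_tuple prednK.
rewrite leq_add2r; apply: subset_leq_card; apply/subsetP => c; rewrite !inE.
rewrite QV ?size_tuple // ek => /eqP h.
have n0' : n%:Z != 0 by rewrite eqz_nat -lt0n.
by apply/eqP/(mulfI n0')/eqP; rewrite mulrN -addr_eq0 addrC [n%:Z * k]mulrC h.
Qed.

(** The remaining words have the form [A u A] with [net u = -2], and
    [0 = 1 + (moment u + net u) + n]. *)
Lemma leq_run_set1 :
  (#|run_set n a a 0 1| <= #|isolated_set| +
     nwords (n - 2) [pred w | content (a - 2) a w & moment w == (1 - n%:Z)%R])%N.
Proof.
rewrite -(cardsID isolated_set) leq_add ?subset_leq_card ?subsetIr //.
pose f (x : n.-tuple letter * 'I_n) : seq letter := take (n - 2) (behead x.1).
have fP x : x \in run_set n a a 0 1 :\: isolated_set ->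
    val x.2 = 0%N /\ tval x.1 = A :: rcons (f x) A.
  case: x => w j; rewrite !inE /= => /andP [+ hx]; rewrite hx /= negbK => /eqP lx.
  have /run_setP [u [z [ew lu su ez]]] : (w, j) \in run_set n a a 0 1.
    by rewrite inE.
  have su' : size u = j by lia.
  have ew' : tval w = u ++ A :: z by [].
  have u0 : u = [::].
    move: lx; rewrite -ez -{1}su' ew' take_size_cat // last_cat.
    by case: u lu {su ew su' ew'} => //= y u lu e; rewrite e eqxx in lu.
  have j0 : nat_of_ord j = 0%N by rewrite -su' u0.
  split=> //; rewrite /f ew' u0 /=; congr (_ :: _).
  have sz : size z = n.-1 by rewrite ez size_drop size_tuple j0 subn1.
  move: lx; rewrite -ez j0 take0 cats0.
  case/lastP: z sz {ew ez ew'} => [|z y]; first by rewrite /=; lia.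
  rewrite last_rcons size_rcons => sz ->.
  by congr rcons; rewrite -cats1 take_size_cat // subn2 -sz.
apply: (@leq_card_nwords _ _ _ _ f) => [x y /fP [x2 x1] /fP [y2 y1] e|x xS].
  case: x y x2 x1 y2 y1 e => [w j] [w' j'] /= j0 ew j0' ew' e.
  congr (_, _); apply: val_inj; last by rewrite /= j0 j0'.
  by rewrite /= ew ew' e.
have [_ ew] := fP _ xS; move: xS; rewrite !inE => /andP [_ /andP [/andP [cw /eqP mw] _]].
have := congr1 size ew; rewrite size_tuple /= size_rcons => sn.
move: (f x) ew sn => u ew sn; split; first by lia.
have cA : (count_mem A u + 2 = a)%N.
  by have [<- _] := contentP _ _ _ cw; rewrite ew /= -cats1 count_cat /= addn1 addn2.
have cB : (count_mem B u = a)%N.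
  by have [_ <-] := contentP _ _ _ cw; rewrite ew /= -cats1 count_cat /= !addn0.
apply/andP; split; first by apply/contentP; rewrite -cA addnK cB cA.
move: mw; rewrite ew /= -cats1 moment_cat net_cat netE cB -cA /= => mw.
by apply/eqP; lia.
Qed.

End Cyclic.

(** * Permutations and words *)

Definition label (a i : nat) : letter :=
  if (i < a)%N then A else if (i < a + a)%N then B else O.

Section Words.
Variables (a n : nat).
Hypothesis n_gt2a : (2 * a < n)%N.

Definition word (s : 'S_n) : n.-tuple letter :=
  [tuple label a ((s^-1)%g j) | j < n].

Lemma momentE (w : n.-tuple letter) :
  moment w = \sum_(j < n) (j.+1)%:Z * charge (tnth w j).
Proof.
have netS (u : seq letter) : net u = \sum_(j < size u) charge (nth O u j).
  by elim: u => [|x u IH]; rewrite ?big_ord0 // big_ord_recl /= IH.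
have mS (u : seq letter) : moment u = \sum_(j < size u) (j.+1)%:Z * charge (nth O u j).
  elim: u => [|x u IH]; rewrite ?big_ord0 // big_ord_recl /= mul1r IH netS -addrA.
  congr (_ + _); rewrite -big_split; apply: eq_bigr => j _ /=.
  by rewrite /bump /= add1n -[j.+2]addn1 PoszD; ring.
rewrite mS size_tuple; apply: eq_bigr => j _.
by rewrite (tnth_nth O).
Qed.

Lemma D_word s : D a a s = moment (word s).
Proof.
rewrite momentE (reindex_inj (@perm_inj _ s)) /D.
rewrite big_mkcond [X in _ - X]big_mkcond -sumrB; apply: eq_bigr => i _.
rewrite tnth_mktuple permK /label.
case: (ltnP i a) => [ia|ia] /=; first by ring.
by case: ifP => _ /=; ring.
Qed.

Lemma word_perm s : perm_eq (word s) (word 1%g).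
Proof.
apply/tuple_permP; exists (s^-1)%g; congr tval.
by apply: eq_from_tnth => j; rewrite !tnth_mktuple invg1 perm1.
Qed.

Lemma content_word1 : content a a (word 1%g).
Proof.
have -> : tval (word 1%g) = [seq label a i | i <- iota 0 n].
  rewrite /= -val_enum_ord -map_comp; apply: eq_map => j /=.
  by rewrite invg1 perm1.
have -> : n = (a + (a + (n - a - a)))%N by lia.
rewrite !iotaD !map_cat add0n.
have labelE x k m : (forall i, m <= i < m + k -> label a i = x)%N ->
    map (label a) (iota m k) = nseq k x.
  elim: k m => //= k IH m h; rewrite IH => [|i hi]; last by apply: h; lia.
  by rewrite h //; lia.
rewrite (labelE A) => [|i hi]; last by rewrite /label ifT //; lia.
rewrite (labelE B) => [|i hi]; last first.
  by rewrite /label ifF ?ifT //; lia.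
rewrite (labelE O) => [|i hi]; last first.
  by rewrite /label ifF ?ifF //; lia.
by apply/contentP; rewrite !count_cat !count_nseq /=; lia.
Qed.

Lemma content_perm (w : n.-tuple letter) :
  content a a w = perm_eq w (word 1%g).
Proof.
have [cA cB] := contentP _ _ _ content_word1.
have szE (u : seq letter) :
    size u = (count_mem A u + count_mem B u + count_mem O u)%N.
  by elim: u => //= -[[]|] u -> /=; lia.
apply/contentP/idP => [[wA wB]|/seq.permP e]; last by rewrite !e.
have sO : count_mem O w = count_mem O (word 1%g).
  have := szE w; rewrite wA wB; have := szE (word 1%g); rewrite cA cB !size_tuple.
  by move=> h1 h2; apply: (@addnI (a + a)%N); rewrite -h1 -h2.
by apply/allP => -[[]|] _; rewrite /= ?cA ?cB ?wA ?wB ?sO.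
Qed.

(** A permutation [t] of the values carrying one word to the other translates the fibres by right
    multiplication. *)
Lemma card_fibre (w : n.-tuple letter) : content a a w ->
  #|[set s | word s == w]| = #|[set s | word s == word 1%g]|.
Proof.
rewrite content_perm => /tuple_permP [t et].
have {}et : w = [tuple tnth (word 1%g) (t j) | j < n] by apply: val_inj.
rewrite -(card_imset _ (mulIg t)); apply: eq_card => s; rewrite inE.
have tw j : tnth w j = label a (t j) by rewrite et !tnth_mktuple invg1 perm1.
apply/imsetP/eqP => [[r +] ->|es].
  rewrite inE => /eqP er; apply: eq_from_tnth => j.
  rewrite !tnth_mktuple invMg permM invg1 perm1.
  have := tw (t^-1 j)%g; rewrite -er permKV => <-.
  by rewrite tnth_mktuple.
exists (s * t^-1)%g; last by rewrite mulgKV.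
rewrite inE; apply/eqP/eq_from_tnth => j.
have := congr1 (fun v => tnth v (t j)) es; rewrite /word !tnth_mktuple invg1 perm1 => e.
by rewrite tw -e invMg invgK permM.
Qed.

Lemma card_perm_word (P : pred (seq letter)) :
  #|[set s : 'S_n | P (word s)]| =
  (#|[set s | word s == word 1%g]| * nwords n [pred w | content a a w & P w])%N.
Proof.
rewrite -[LHS]sum1dep_card (partition_big word (fun w : n.-tuple letter => content a a w && P w)).
  rewrite mulnC /nwords -sum_nat_const; apply: eq_big => [w|w /andP [cw Pw]].
    by rewrite inE.
  rewrite -(card_fibre _ cw) -sum1dep_card; apply: eq_bigl => s.
  by case: eqP => [->|_]; rewrite ?Pw ?andbF.
by move=> s Ps; rewrite Ps andbT content_perm word_perm.
Qed.

Lemma uniform_Pr_word :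
  uniform_Pr [set s : 'S_n | D a a s == 0] =
  (nwords n [pred w | content a a w & moment w == 0])%:R / (nwords n (content a a))%:R.
Proof.
rewrite /uniform_Pr.
have -> : #|[set s : 'S_n | D a a s == 0]| = #|[set s : 'S_n | moment (word s) == 0]|.
  by apply: eq_card => s; rewrite !inE D_word.
rewrite (card_perm_word (fun w => moment w == 0)) -cardsT.
have -> : [set: 'S_n] = [set s : 'S_n | xpredT (tval (word s))].
  by apply/setP => s; rewrite !inE.
rewrite (card_perm_word xpredT) !natrM -mulf_div divff ?mul1r.
  by congr (_ / _%:R); apply: eq_nwords => w /=; rewrite andbT.
rewrite pnatr_eq0 -lt0n; apply/card_gt0P; exists 1%g; by rewrite inE.
Qed.

End Words.

(** * Combination of the bounds *)

Lemma leq_run_set_dvd (a n k : nat) : (1 < k)%N -> (k <= a)%N -> (2 * a < n)%N ->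
  (2 * (n - k - 1) * #|run_set n a a 0 k|
   <= (n - k) * nwords (n - k) (content (a - k) a))%N.
Proof.
move=> k1 ka an.
have hk : (0 < a - k + a < n - k)%N by lia.
(* The rest has net charge [- k], so the block in front of it adds exactly [s] to its moment. *)
pose s : int := moment (nseq k A) - k%:Z * k%:Z.
have := nwords_dvd_moment_le k (n - k) (a - k) a s k1 hk.
rewrite -subn1; apply: leq_trans; rewrite leq_mul2l; apply/orP; right.
apply: leq_trans (leq_run_set _ _ _ _ _ _) _; first by lia.
apply: leq_nwords => w _ /andP [cw]; rewrite /= cw subr0 moment_cat size_nseq.
have -> : net w = - k%:Z by rewrite (content_net _ _ _ cw); lia.
by rewrite /s; congr (_ %| _)%Z; ring.
Qed.

(** [X] and [P] account for blocks of length 1, cyclically isolated or opening a word that ends with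
    [A]; [E] for length 2 and [S] for longer blocks. *)
Lemma run_bounds (a n : nat) : (2 <= a)%N -> (2 * a < n)%N ->
  let w := nwords (n - 2) (content (a - 2) a) in
  exists X P E S : nat,
  [/\ (a * nwords n [pred w | content a a w & moment w == 0] <= X + P + E + S)%N,
      ((a - 1) * X <= (n - a) * w)%N,
      ((if a == 2 then n - 3 else n - a + 1) * P <= w)%N,
      (2 * (n - 3) * E <= (n - 2) * w)%N
    & (2 * (n - a - 1) * (n - a + 1) * S <= (n - a) * (a - 2) * w)%N].
Proof.
move=> a2 an w.
have a0 : (0 < a)%N by lia.
pose X := #|isolated_set n a|.
pose P := nwords (n - 2) [pred w | content (a - 2) a w & moment w == 1 - n%:Z].
pose E := #|run_set n a a 0 2|.
pose S := (\sum_(k < a - 2) #|run_set n a a 0 k.+3|)%N.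
exists X, P, E, S; split.
- apply: leq_trans (leq_sum_run_set _ _ _ _) _.
  have split2 (F : nat -> nat) :
      (\sum_(k < a) F k = F 0 + F 1 + \sum_(k < a - 2) F k.+2)%N.
    case: (a) a2 => [|[|m]] // _; rewrite subn2 !big_ord_recl /= addnA.
    by congr (_ + _)%N; apply: eq_bigr.
  rewrite (split2 (fun k => #|run_set n a a 0 k.+1|)) !leq_add2r.
  exact: leq_run_set1.
- have h1 := leq_isolated_set n a a0 an; have h2 := cyclic_insertion n a a0 an.
  have e := nwords_content_step (n - 2) (a - 2) a.
  have en : (n - 2).+1 = n.-1 by lia.
  have ea : (a - 2).+1 = a.-1 by lia.
  rewrite en ea -/w in e.
  rewrite -(leq_pmul2l (_ : 0 < n.-1)%N); last by lia.
  apply: leq_trans (_ : (a - 1) * ((n - a) * nwords n.-1 (content a.-1 a)) <= _)%N.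
    rewrite mulnCA leq_mul2l; apply/orP; right.
    apply: leq_trans (_ : n.-1 * ((n - a) * nwords n.-1 _) <= _)%N.
      exact: leq_mul h1.
    by rewrite mulnCA; exact: leq_mul h2.
  by rewrite mulnCA subn1 -e mulnCA.
(* For [a = 2] the inner word has no [A], so its two [B]s are used instead. *)
- rewrite /P /w; case: eqP => [a_eq2|a_neq2].
    have := moment_concentration_flip (n - 4) (a - 2) a (1 - n%:Z) a0.
    rewrite a_eq2; have -> : (n - 4 + 2 = n - 2)%N by lia.
    by have -> : (n - 4).+1 = (n - 3)%N by lia.
  have a3 : (0 < a - 2)%N by lia.
  have := moment_concentration (n - a) (a - 2) a (1 - n%:Z) a3.
  have -> : (n - a + (a - 2) = n - 2)%N by lia.
  by rewrite addn1.
- have := leq_run_set_dvd a n 2 isT a2 an.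
  by have -> : (n - 2 - 1 = n - 3)%N by lia.
have d2 : (1 < n - a)%N by lia.
have hS : (2 * (n - a - 1) * S <= (n - a) * \sum_(k < a - 2)
    nwords (n - 2 - k.+1) (content (a - 2 - k.+1) a))%N.
  rewrite /S !big_distrr; apply: leq_sum => k _.
  have ka : (k.+3 <= a)%N by have := ltn_ord k; lia.
  have := leq_run_set_dvd a n k.+3 isT ka an.
  have -> : (n - 2 - k.+1 = n - k.+3)%N by lia.
  have -> : (a - 2 - k.+1 = a - k.+3)%N by lia.
  (* The ratio [m / (m - 1)] decreases, so its value at [n - a] serves all block lengths. *)
  have : (n - a <= n - k.+3)%N by lia.
  move: (n - k.+3)%N (n - a)%N d2 => m d d2 dm.
  move: (nwords m _) #|_| => W R h /=.
  rewrite -(leq_pmul2l (_ : 0 < m - 1)%N); last by lia.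
  apply: leq_trans (_ : (d - 1) * (m * W) <= _)%N; first by nia.
  by rewrite !mulnA leq_mul2r; apply/orP; right; nia.
have := nwords_content_sum (n - a) (a - 2) a.
have -> : (n - a + (a - 2) = n - 2)%N by lia.
rewrite -/w => hsum.
rewrite mulnAC -[X in (_ <= X)%N]mulnA -hsum mulnCA [X in (X <= _)%N]mulnC addn1.
by rewrite leq_mul2l hS orbT.
Qed.

Lemma nwords_content_two a n : (2 <= a)%N -> (2 * a < n)%N ->
  (a * (a - 1) * nwords n (content a a) =
   n * (n - 1) * nwords (n - 2) (content (a - 2) a))%N.
Proof.
move=> a2 an; have := nwords_content_step (n - 2) (a - 2) a.
have := nwords_content_step (n - 1) (a - 1) a.
have -> : (n - 2).+1 = (n - 1)%N by lia.
have -> : (a - 2).+1 = (a - 1)%N by lia.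
have -> : (n - 1).+1 = n by lia.
have -> : (a - 1).+1 = a by lia.
by move=> h1 h2; rewrite mulnAC -h1 mulnAC -(mulnA n) -mulnA h2; ring.
Qed.

(** Clears denominators: [a1], [a2], [n2], [n3] stand for [a - 1], [a - 2], [n - 2], [n - 3], and
    [d1], [d], [dp] for [n - a - 1], [n - a], [n - a + 1]. *)
Lemma combine_bounds (a1 a2 n2 n3 d d1 dp T X P E S w : nat) :
  (T <= X + P + E + S)%N -> (a1 * X <= d * w)%N -> (dp * P <= w)%N ->
  (2 * n3 * E <= n2 * w)%N -> (2 * d1 * dp * S <= d * a2 * w)%N ->
  (2 * n3 * d1 * dp * (a1 * T) <=
   (2 * n3 * d1 * dp * d + a1 * (2 * n3 * d1 + n2 * d1 * dp + a2 * d * n3)) * w)%N.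
Proof.
move=> hT hX hP hE hS.
have {}hT := leq_mul (leqnn (2 * n3 * d1 * dp * a1)) hT.
have {}hX := leq_mul (leqnn (2 * n3 * d1 * dp)) hX.
have {}hP := leq_mul (leqnn (a1 * 2 * n3 * d1)) hP.
have {}hE := leq_mul (leqnn (a1 * d1 * dp)) hE.
have {}hS := leq_mul (leqnn (a1 * n3)) hS.
lia.
Qed.

(** After the substitutions, right side minus left side has nonnegative coefficients in [i] and [j].
    At [a = 3], [n = 8] the inequality fails. *)
Lemma gap_polynomial a n : (2 < a)%N -> (2 * a + 1 < n)%N -> ~ (a = 3 /\ n = 8)%N ->
  (3 * ((a - 1) * (2 * (n - 3) * (n - a - 1) + (n - 2) * (n - a - 1) * (n - a + 1)
     + (a - 2) * (n - a) * (n - 3)))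
   <= 2 * (n - 3) * (n - a - 1) * (n - a + 1) * (3 * a - 4))%N.
Proof.
move=> a3 an a3n; have [a_eq3|a_neq3] := eqVneq a 3%N.
  have [j ej] : {j | n = (j + 9)%N} by exists (n - 9)%N; lia.
  rewrite a_eq3 ej.
  have -> : (j + 9 - 3 = j + 6)%N by lia.
  have -> : (j + 9 - 2 = j + 7)%N by lia.
  have -> : (j + 6 - 1 = j + 5)%N by lia.
  have [j2 j3] : (0 <= j * j)%N /\ (0 <= j * j * j)%N by [].
  lia.
have [i ei] : {i | a = (i + 4)%N} by exists (a - 4)%N; lia.
have [j ej] : {j | n = (2 * i + j + 10)%N} by exists (n - 2 * i - 10)%N; lia.
rewrite ej ei.
have -> : (2 * i + j + 10 - 3 = 2 * i + j + 7)%N by lia.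
have -> : (2 * i + j + 10 - 2 = 2 * i + j + 8)%N by lia.
have -> : (2 * i + j + 10 - (i + 4) = i + j + 6)%N by lia.
have -> : (i + j + 6 - 1 = i + j + 5)%N by lia.
have -> : (i + 4 - 1 = i + 3)%N by lia.
have -> : (i + 4 - 2 = i + 2)%N by lia.
have -> : (3 * (i + 4) - 4 = 3 * i + 8)%N by lia.
have : [&& 0 <= i * i, 0 <= i * i * i, 0 <= i * i * i * j, 0 <= i * i * j, 0 <= i * j,
  0 <= i * i * j * j, 0 <= i * j * j, 0 <= j * j, 0 <= i * j * j * j
  & 0 <= j * j * j]%N by [].
lia.
Qed.

(** The bounds add up to [n - 2 + n / (2 * (n - 3))] times [w], which is at most [n - 4 / 3] times
    [w] from [n = 12] on. *)
Lemma gap_two n T X P E w : (12 <= n)%N -> (T <= X + P + E)%N ->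
  (X <= (n - 2) * w)%N -> ((n - 3) * P <= w)%N -> (2 * (n - 3) * E <= (n - 2) * w)%N ->
  (3 * T <= (3 * n - 4) * w)%N.
Proof.
move=> n12; have [m ->] : {m | n = (m + 12)%N} by exists (n - 12)%N; lia.
have -> : (m + 12 - 2 = m + 10)%N by lia.
have -> : (m + 12 - 3 = m + 9)%N by lia.
have -> : (3 * (m + 12) - 4 = 3 * m + 32)%N by lia.
move=> hT hX hP hE; rewrite -(leq_pmul2l (_ : 0 < 2 * (m + 9))%N); last by lia.
have {}hT := leq_mul (leqnn (6 * (m + 9))) hT.
have {}hX := leq_mul (leqnn (6 * (m + 9))) hX.
have mw : (0 <= m * w)%N by [].
lia.
Qed.

Section Bounds.
Variables (a n : nat).
Hypotheses (a_ge2 : (2 <= a)%N) (n_gt2a : (2 * a < n)%N).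

Let G := nwords n [pred w | content a a w & moment w == 0].
Let W := nwords n (content a a).
Let w := nwords (n - 2) (content (a - 2) a).

Let e : (a * (a - 1) * W = n * (n - 1) * w)%N := nwords_content_two a n a_ge2 n_gt2a.

Let scale q c : (q * ((a - 1) * (a * G)) <= c * w)%N ->
  (q * (n * (n - 1) * G) <= c * W)%N.
Proof.
move=> h; have e' := congr1 (muln c) e.
rewrite -(leq_pmul2l (_ : 0 < a * (a - 1))%N); last by rewrite muln_gt0; lia.
have := leq_mul (leqnn (n * (n - 1))) h; move: (a - 1)%N (n - 1)%N e' => a1 n1 e'.
lia.
Qed.

Let w_gt0 : (0 < w)%N.
Proof. by rewrite /w nwords_contentE muln_gt0 !bin_gt0; lia. Qed.

Lemma gap_bound : n <> (2 * a + 1)%N -> (a = 2 -> 12 <= n)%N ->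
  ~ (a = 3 /\ n = 8)%N -> (3 * (n * (n - 1) * G) <= (3 * n - 4) * W)%N.
Proof.
move=> n1 a2n a3n; apply: scale.
have [X [P [E [S [hT hX hP hE hS]]]]] := run_bounds a n a_ge2 n_gt2a.
rewrite -/w -/G in hT hX hP hE hS.
have [a2|a2] := eqVneq a 2%N.
  rewrite a2 /= in hT hX hP hE hS.
  have S0 : S = 0%N.
    by move: hS; rewrite subnn muln0 mul0n leqn0 !muln_eq0; lia.
  rewrite S0 addn0 in hT; rewrite mul1n in hX; rewrite a2 mul1n.
  exact: gap_two (a2n a2) hT hX hP hE.
rewrite (negbTE a2) in hP.
have := combine_bounds _ _ _ _ _ _ _ _ _ _ _ _ _ hT hX hP hE hS.
have := gap_polynomial a n; set K := (_ + _ + _)%N; set M := (_ * (n - a + 1))%N.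
move=> hK hM; have {}hK : (3 * ((a - 1) * K) <= M * (3 * a - 4))%N by apply: hK; lia.
rewrite -(leq_pmul2l (_ : 0 < M)%N); last by rewrite !muln_gt0; lia.
have {}hK := leq_mul hK (leqnn w).
(* The part [3 * (n - a)] covers [X]; [gap_polynomial] fits the rest into [3 * a - 4]. *)
have -> : (3 * n - 4 = 3 * (n - a) + (3 * a - 4))%N by lia.
lia.
Qed.

(** Against the target [n - 1], the bound on [X] leaves room [a - 1] for the other terms, and
    [K < M] suffices. *)
Lemma strict_bound : (2 < a)%N -> n = (2 * a + 1)%N -> (n * G < W)%N.
Proof.
move=> a3 n1.
have [X [P [E [S [hT hX hP hE hS]]]]] := run_bounds a n a_ge2 n_gt2a.
rewrite -/w -/G in hT hX hP hE hS; rewrite gtn_eqF // in hP.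
have := combine_bounds _ _ _ _ _ _ _ _ _ _ _ _ _ hT hX hP hE hS.
set K := (_ + _ + _)%N; set M := (_ * (n - a + 1))%N => hM.
have M0 : (0 < M)%N by rewrite !muln_gt0; lia.
have hK : (K < M)%N.
  rewrite /K /M; have [i ei] : {i | a = (i + 3)%N} by exists (a - 3)%N; lia.
  have -> : (n - 3 = 2 * i + 4)%N by lia.
  have -> : (n - 2 = 2 * i + 5)%N by lia.
  have -> : (n - a = i + 4)%N by lia.
  have -> : (a - 2 = i + 1)%N by lia.
  have -> : (i + 4 - 1 = i + 3)%N by lia.
  have : (0 <= i * i)%N by [].
  lia.
have hw : ((a - 1) * (a * G) < (n - 1) * w)%N.
  rewrite -(ltn_pmul2l M0); apply: leq_ltn_trans hM _.
  rewrite mulnA ltn_pmul2r //.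
  have -> : (n - 1 = (n - a) + (a - 1))%N by lia.
  by rewrite mulnDr ltn_add2l mulnC ltn_pmul2r //; lia.
rewrite -(ltn_pmul2l (_ : 0 < a * (a - 1))%N); last by rewrite muln_gt0; lia.
rewrite e; have n0 : (0 < n)%N by lia.
have := hw; rewrite -(ltn_pmul2l n0); move: (a - 1)%N (n - 1)%N => a1 m1; lia.
Qed.

End Bounds.

(** * Small cases and conclusion *)

(** A computable count by the first letter: [c] letters have been read and [s] is the moment still
    to be reached. *)
Fixpoint count_moment (m a b : nat) (c s : int) : nat :=
  if m is m'.+1 then
    ((if a is a'.+1 then count_moment m' a' b (c + 1) (s - (c + 1))%R else 0)
     + (if b is b'.+1 then count_moment m' a b' (c + 1) (s + (c + 1))%R else 0)
     + count_moment m' a b (c + 1)%R s)%N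
  else [&& a == 0%N, b == 0%N & s == 0].

Lemma count_momentE m a b c s :
  nwords m [pred w | content a b w & moment w + c * net w == s] = count_moment m a b c s.
Proof.
elim: m a b c s => [|m IH] a b c s.
  rewrite nwords0 /content /= mulr0 addr0 !(eq_sym 0%N) (eq_sym 0) -andbA //.
rewrite nwordsS /=; congr (_ + _ + _)%N.
- case: a => [|a]; first by apply: etrans (nwords_pred0 m); apply: eq_nwords.
  rewrite -IH; apply: eq_nwords => w; rewrite /content /= add1n eqSS; congr (_ && _ && _).
  by apply/eqP/eqP => h; lia.
- case: b => [|b]; first by
    apply: etrans (nwords_pred0 m); apply: eq_nwords => w; rewrite /content /= andbF.
  rewrite -IH; apply: eq_nwords => w; rewrite /content /= add1n eqSS; congr (_ && _ && _).
  by apply/eqP/eqP => h; lia.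
- rewrite -IH; apply: eq_nwords => w; rewrite /content /=; congr (_ && _ && _).
  by apply/eqP/eqP => h; lia.
Qed.

Lemma moment_eq_nwords n a b :
  nwords n [pred w | content a b w & moment w == 0] = count_moment n a b 0 0.
Proof. by rewrite -count_momentE; apply: eq_nwords => w /=; rewrite mul0r addr0. Qed.

(** The moment is the difference of the positions of the two charged letters. *)
Lemma moment_one_one n : nwords n [pred w | content 1 1 w & moment w == 0] = 0%N.
Proof.
have mA w : count_mem B w = 0%N -> (count_mem A w)%:Z <= moment w.
  by elim: w => //= x w IH; rewrite netE; case: x => [[]|] /=; lia.
have mB w : count_mem A w = 0%N -> moment w <= - (count_mem B w)%:Z.
  by elim: w => //= x w IH; rewrite netE; case: x => [[]|] /=; lia.
apply: etrans (nwords_pred0 n); apply: eq_nwords => w; apply/negP => /= /andP [].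
elim: w => [|x w IH] //= /contentP [] /=; rewrite netE.
case: x => [[]|] /= cA cB.
- have {}cA : count_mem A w = 0%N by case: cA.
  have := mB w cA; rewrite cA.
  by move: cB (moment w); rewrite add0n => -> m mle /eqP; lia.
- have {}cB : count_mem B w = 0%N by case: cB.
  have := mA w cB; rewrite cB.
  by move: cA (moment w); rewrite add0n => -> m mle /eqP; lia.
- move: cA cB; rewrite !add0n => cA cB; rewrite cA cB subrr !add0r.
  by apply: IH; apply/contentP.
Qed.

(** The claims for [p = G / W] without denominators; [(3 * n - 4) / (3 * n * (n - 1))] is
    [1 / n - 1 / (3 * n * (n - 1))]. *)
Definition word_bounds (a n G W : nat) : Prop :=
  [/\ (n * G <= W)%N, ~ (a = 2 /\ n = 5)%N -> (n * G < W)%N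
    & n <> (2 * a + 1)%N -> (3 * (n * (n - 1) * G) <= (3 * n - 4) * W)%N].

Lemma word_bounds_small a n : (2 * a < n)%N ->
  (((a == 2) && (n <= 11)) || ((a == 3) && (n == 8)))%N ->
  word_bounds a n (nwords n [pred w | content a a w & moment w == 0]) (nwords n (content a a)).
Proof.
rewrite moment_eq_nwords nwords_contentE => an small.
pose check b m := let G := count_moment m b b 0 0 in
  let W := ('C(m, b + b) * 'C(b + b, b))%N in
  [&& m * G <= W, ((b == 2) && (m == 5)) || (m * G < W)
    & (m == 2 * b + 1) || (3 * (m * (m - 1) * G) <= (3 * m - 4) * W)]%N.
have : check a n.
  case/orP: small an => /andP [/eqP ->]; last by move/eqP->; vm_compute.
  move=> n11 n5; have : n \in iota 5 7 by rewrite mem_iota; lia.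
  have /allP : all (check 2) (iota 5 7) by vm_compute.
  exact.
case/and3P => h1 h2 h3; split=> // [hn|hn].
  by case/orP: h2 => // /andP [/eqP a2 /eqP n5]; case: hn.
by case/orP: h3 => // /eqP.
Qed.

Lemma word_boundsP a n : (0 < a)%N -> (2 * a < n)%N ->
  word_bounds a n (nwords n [pred w | content a a w & moment w == 0]) (nwords n (content a a)).
Proof.
move=> a0 an; have W0 : (0 < nwords n (content a a))%N.
  by rewrite nwords_contentE muln_gt0 !bin_gt0; lia.
have [a1|a1] := eqVneq a 1%N; first by rewrite a1 moment_one_one in W0 *; split; rewrite !muln0.
have a2 : (1 < a)%N by lia.
have [small|nsmall] := boolP (((a == 2) && (n <= 11)) || ((a == 3) && (n == 8)))%N.
  exact: word_bounds_small.
have [n1|n1] := eqVneq n (2 * a + 1)%N.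
  have h := strict_bound a n a2 an; split=> // *; [apply: ltnW|]; apply: h; lia.
have gap := gap_bound a n a2 an.
have {}gap : (3 * (n * (n - 1) * nwords n [pred w | content a a w & moment w == 0])
    <= (3 * n - 4) * nwords n (content a a))%N by apply: gap; lia.
(* The gap implies strictness, since [3 * n - 4 < 3 * (n - 1)]. *)
suff h : (n * nwords n [pred w | content a a w & moment w == 0] < nwords n (content a a))%N.
  by split=> //; exact: ltnW.
rewrite -(ltn_pmul2l (_ : 0 < 3 * (n - 1))%N); last by lia.
apply: leq_ltn_trans (_ : _ <= (3 * n - 4) * nwords n (content a a))%N _.
  by rewrite -mulnA (mulnCA (n - 1)%N) (mulnA n).
by rewrite ltn_pmul2r //; lia.
Qed.

Theorem theorem6 (a n : nat) (ha : (0 < a)%N) (hn : (2 * a < n)%N) :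
  let p : rat := uniform_Pr [set s : 'S_n | D a a s == 0] in
  [/\ p <= 1 / n%:R,
      ~ (a = 2%N /\ n = 5%N) -> p < 1 / n%:R
    & n <> (2 * a + 1)%N ->
      1 / n%:R - p >= 1 / (3%:R * n%:R * (n%:R - 1))].
Proof.
rewrite /= uniform_Pr_word //; have [] := word_boundsP a n ha hn.
have W0 : (0 < nwords n (content a a))%N by rewrite nwords_contentE muln_gt0 !bin_gt0; lia.
move: (nwords n _) (nwords n _) W0 => G W W0 h1 h2 h3.
have W0' : 0 < W%:R :> rat by rewrite ltr0n.
have n0 : 0 < n%:R :> rat by rewrite ltr0n; lia.
have n1 : 0 < n%:R - 1 :> rat by rewrite subr_gt0 ltr1n; lia.
split=> [|/h2 {}h2|/h3 {}h3].
- by rewrite ler_pdivrMr // mulrAC ler_pdivlMr // mul1r mulrC -natrM ler_nat.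
- by rewrite ltr_pdivrMr // mulrAC ltr_pdivlMr // mul1r mulrC -natrM ltr_nat.
have -> : 1 / n%:R - G%:R / W%:R =
    (W%:R - n%:R * G%:R) / (n%:R * W%:R) :> rat.
  by field; rewrite !lt0r_neq0.
rewrite ler_pdivrMr ?mulr_gt0 // mulrAC ler_pdivlMr ?mulr_gt0 // mul1r.
move: h3; rewrite -(ler_nat rat) !natrM !natrB; try lia.
rewrite natrM => h3; have := ler_wpM2l (ltW n0) h3; lra.
Qed.
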